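(* Let $\pi\colon(X,T)\to(Y,S)$ be a factor map. If $y\in Y$ is an $\mathcal{AP}$-recurrent point, then there exists an $\mathcal{AP}$-recurrent point $x\in X$ such that $\pi(x)=y$.
   Context: A (topological) dynamical system $(X,T)$ consists of a (nonempty) compact metric space and a continuous map $T\colon X\to X$. A factor map $\pi\colon(X,T)\to(Y,S)$ is a continuous surjection $\pi\colon X\to Y$ with $\pi\circ T=S\circ\pi$. $\mathbb{N}$ is the set of positive integers. A set $F\subset\mathbb{N}$ is an AP-set if for every $d\ge1$ there are $a,n\in\mathbb{N}$ with $\{a,a+n,\dots,a+dn\}\subset F$. For $U\subset X$, $N(x,U)=\{n\in\mathbb{N}:T^nx\in U\}$. A point $x\in X$ is $\mathcal{AP}$-recurrent if $N(x,U)$ is an AP-set for every open neighborhood $U$ of $x$ (and similarly for $(Y,S)$). *)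

(* Defs.v *)
From mathcomp Require Import all_boot all_order all_algebra.
From mathcomp Require Import all_classical all_reals topology.

Set Implicit Arguments.
Unset Strict Implicit.
Unset Printing Implicit Defensive.

Local Open Scope classical_set_scope.

Definition dynamical_system (R : realType) (X : metricType R) (T : X -> X) :
    Prop :=
  [/\ [set: X] !=set0, compact [set: X] & continuous T].

Definition factor_map (R : realType) (X Y : metricType R)
    (T : X -> X) (S : Y -> Y) (pi : X -> Y) : Prop :=
  [/\ continuous pi, set_surj [set: X] [set: Y] pi & pi \o T = S \o pi].

(* The natural numbers of the source start at 1, whence the positivity
   conditions on d, a and n here, and on n in [return_times]. *)
Definition AP_set (F : set nat) : Prop :=
  forall d : nat, (0 < d)%N ->
    exists a n : nat, [/\ (0 < a)%N, (0 < n)%N &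
      forall k : nat, (k <= d)%N -> F (a + k * n)%N].

Definition return_times (X : Type) (T : X -> X) (x : X) (U : set X) : set nat :=
  [set n | (0 < n)%N /\ U (iter n T x)].

Definition AP_recurrent (R : realType) (X : metricType R) (T : X -> X)
    (x : X) : Prop :=
  forall U : set X, open_nbhs x U -> AP_set (return_times T x U).

(* Main.v *)
Require Import Defs.
From mathcomp Require Import all_boot all_order all_algebra.
From mathcomp Require Import all_classical all_reals topology.
From mathcomp Require Import zify.

Set Implicit Arguments.
Unset Strict Implicit.
Unset Printing Implicit Defensive.

(** The proof looks for a recurrent point among limit sets.  For a point [x] of
a system [T], call [z] an AP-limit of [x] when [x] visits every neighbourhood
of [z] along an AP-set; AP-recurrence of [x] means that [x] is an AP-limit of
itself.  Three facts carry the argument.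

- AP-limits are transitive ([AP_limit_set_trans]): a progression of visits of
  [z] to an open set is copied, up to a shift, by any iterate of [x] that is
  close enough to [z].
- If [y = pi x] is AP-recurrent, then [x] has an AP-limit in the fibre of [y]
  ([AP_limit_set_fiber]).  This is a compactness argument, and it works because
  AP-sets are partition regular ([AP_setU]), which is van der Waerden's theorem
  in disguise.
- The set [M x] of AP-limits of [x] in the fibre of [y] is closed, hence a
  decreasing chain of sets of this form has a common point [w] by compactness;
  transitivity puts [M w] below the whole chain.

Zorn's lemma then yields [x] in the fibre with [M x] minimal.  Any [z] in
[M x] satisfies [M z `<=` M x] by transitivity, so [M z = M x] contains [z],
and [z] is an AP-recurrent point above [y]. *)

(** * Van der Waerden's theorem *)

(** The bound asks for one more step [n] than the [d.+1] terms use: together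
with [(0 < n)%N] it keeps [n] itself below [N], which [equal_windows] uses to
step back from the first term. *)
Definition mono_AP (C : Type) (c : nat -> C) (d N : nat) : Prop :=
  exists a n : nat, [/\ (0 < n)%N, (a + n * d.+1 < N)%N &
    forall k, (k <= d)%N -> c (a + k * n)%N = c a].

(** The usual notion of [s] colour-focused progressions: [s] monochromatic
progressions of length [d], of pairwise distinct colours, all of which would
have the focus [f] as the term preceding the first one.  Indexing them by the
set [Q] of their colours encodes distinctness. *)
Definition colour_focused (C : finType) (c : nat -> C) (d s N : nat) : Prop :=
  exists (f : nat) (Q : {set C}), [/\ (f < N)%N, #|Q| = s &
    forall q, q \in Q -> exists n : nat,
      [/\ (0 < n)%N, (f + n * d.+1 < N)%N &
        forall k, (0 < k <= d)%N -> c (f + k * n)%N = q]].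

(** A colouring of the windows of length [N] is again a finite colouring, so a
progression of [d.+1] identical windows exists.  The position [b] one step
before it, whose window is arbitrary, is where the next focus will lie. *)
Lemma equal_windows (d : nat) (C : finType) (N : nat) :
  (forall C' : finType, exists M, forall c : nat -> C', mono_AP c d M) ->
  exists M, forall c : nat -> C, exists b m : nat,
    [/\ (0 < m)%N, (b + m * d.+2 < M)%N &
      forall k i, (0 < k <= d.+1)%N -> (i < N)%N ->
        c (b + k * m + i)%N = c (b + m + i)%N].
Proof.
move=> /(_ {ffun 'I_N -> C}) [M vdwM]; exists (M + M)%N => c.
(* Colouring only the positions from [M] on leaves room for a step [m < M] to
   the left of the progression. *)
have [a [m [m0 am win]]] := vdwM (fun b => [ffun i : 'I_N => c (M + b + i)%N]).
exists (M + a - m)%N, m; split=> // [|k i kd iN]; first by nia.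
have := win k.-1 ltac:(lia) => /ffunP/(_ (Ordinal iN)).
rewrite !ffunE /= => eqw.
rewrite [RHS](_ : _ = c (M + a + i)%N); last by congr c; nia.
by rewrite -eqw; congr c; nia.
Qed.

(** Each of the identical windows contains the same [s] focused progressions
and the same focus.  Moving along a progression and along the windows at the
same time makes all of them focus one window earlier; the copies of the old
focus form a further progression with that same new focus.  Its colour is new,
since otherwise the old focus already prolongs one of the [s] progressions. *)
Lemma colour_focusing (d : nat) (C : finType) (s : nat) :
  (forall C' : finType, exists M, forall c : nat -> C', mono_AP c d M) ->
  exists N, forall c : nat -> C, mono_AP c d.+1 N \/ colour_focused c d.+1 s N.
Proof.
move=> vdw; elim: s => [|s [N IH]].
  exists 1%N => c; right; exists 0%N, finset.set0.
  by split; rewrite ?cards0// => q; rewrite finset.in_set0.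
have [M windows] := equal_windows C N vdw.
exists (M + N)%N => c; have [b [m [m0 bm win]]] := windows c.
have [[a [n [n0 an mono]]]|[f [Q [fN cardQ foc]]]] := IH (fun i => c (b + m + i)%N).
  left; exists (b + m + a)%N, n; split=> // [|k kd]; first by nia.
  by rewrite -addnA mono.
(* Either the focus prolongs a progression of its own colour, or it brings a
   new colour. *)
have [cfQ|cfQ] := boolP (c (b + m + f)%N \in Q).
  have [n [n0 fn mono]] := foc _ cfQ.
  left; exists (b + m + f)%N, n; split=> // [|[|k] kd]; first by nia.
    by rewrite mul0n addn0.
  by rewrite -addnA mono.
right; exists (b + f)%N, (c (b + m + f)%N |: Q); split; first by lia.
  by rewrite cardsU1 cfQ cardQ.
move=> q /setU1P[->|qQ].
  exists m; split=> // [|k kd]; first by nia.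
  by rewrite addnAC win.
have [n [n0 fn mono]] := foc _ qQ.
exists (n + m)%N; split=> [||k kd]; [by lia|by nia|].
rewrite -(mono k kd) -(win k)//; last by nia.
by congr c; nia.
Qed.

(** There cannot be more focused progressions than colours. *)
Theorem van_der_Waerden (d : nat) (C : finType) :
  exists N, forall c : nat -> C, mono_AP c d N.
Proof.
elim: d C => [|d IH] C.
  (* A single term: [N = 2] leaves room for the step [1] demanded by the bound. *)
  exists 2%N => c; exists 0%N, 1%N; split=> // k; rewrite leqn0 => /eqP ->.
  by rewrite mul0n.
have [N focN] := colour_focusing C #|C|.+1 IH; exists N => c.
have [//|[f [Q [_ cardQ _]]]] := focN c.
by have := max_card (mem Q); rewrite cardQ ltnn.
Qed.

Local Open Scope classical_set_scope.

(** * Partition regularity of AP-sets *)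

Lemma AP_setS (E F : set nat) : E `<=` F -> AP_set E -> AP_set F.
Proof.
move=> EF apE d d0; have [a [n [a0 n0 En]]] := apE d d0.
by exists a, n; split=> // k kd; exact/EF/En.
Qed.

(** Suppose [E] has no progression of length [d1] and [F] none of length [d2].
A long progression in the union is coloured by membership in [E]; a
monochromatic progression of indices of length [d1 + d2] gives a progression
inside [E] or inside [F], a contradiction. *)
Lemma AP_setU (E F : set nat) : AP_set (E `|` F) -> AP_set E \/ AP_set F.
Proof.
move=> apEF; apply: contrapT => /not_orP[].
move=> /existsNP[d1 /not_implyP[d10 nE]] /existsNP[d2 /not_implyP[d20 nF]].
have [N vdw] := van_der_Waerden (d1 + d2) bool.
have [a [n [a0 n0 EFn]]] := apEF N.+1 isT.
have [b [m [m0 bm mono]]] := vdw (fun i => `[< E (a + i * n)%N >]).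
have [Eb|nEb] := pselect (E (a + b * n)%N).
  apply: nE; exists (a + b * n)%N, (m * n)%N; split; rewrite ?muln_gt0 ?m0//.
    by lia.
  move=> k kd; have := mono k ltac:(lia); rewrite (asboolT Eb) => /asboolP.
  by rewrite mulnDl addnA mulnA.
apply: nF; exists (a + b * n)%N, (m * n)%N; split; rewrite ?muln_gt0 ?m0//.
  by lia.
move=> k kd; have := mono k ltac:(lia); rewrite (asboolF nEb) => /asboolPn.
rewrite mulnDl addnA -mulnA.
have := EFn (b + k * m)%N ltac:(nia); rewrite mulnDl addnA -mulnA.
by case.
Qed.

(** * AP-limit sets *)

Lemma return_timesS (X : Type) (T : X -> X) (x : X) (U V : set X) :
  U `<=` V -> return_times T x U `<=` return_times T x V.
Proof. by move=> UV n [n0 /UV]. Qed.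

Definition AP_limit_set (X : topologicalType) (T : X -> X) (x : X) : set X :=
  [set z | forall U, nbhs z U -> AP_set (return_times T x U)].

Lemma closed_AP_limit_set (X : topologicalType) (T : X -> X) (x : X) :
  closed (AP_limit_set T x).
Proof.
move=> z clz U; rewrite nbhsE => -[V [oV Vz] VU].
have [w [limw Vw]] := clz _ (open_nbhs_nbhs (conj oV Vz)).
by apply: AP_setS (return_timesS VU) _; apply: limw; exact: open_nbhs_nbhs.
Qed.

Lemma continuous_iter (X : topologicalType) (T : X -> X) (n : nat) :
  continuous T -> continuous (iter n T).
Proof.
move=> cT; elim: n => [|n IH] x; first exact: cvg_id.
by apply: (@continuous_comp _ _ _ (iter n T) T); [exact: IH|exact: cT].
Qed.

(** Being sent into an open set by the finitely many iterates
[a, a + n, ..., a + d * n] is an open condition, satisfied at [z] and so at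
some iterate [b] of [x]. *)
Lemma AP_limit_set_trans (X : topologicalType) (T : X -> X) (x z : X) :
  continuous T -> AP_limit_set T x z -> AP_limit_set T z `<=` AP_limit_set T x.
Proof.
move=> cT limz w limw U; rewrite nbhsE => -[V [oV Vw] VU] d d0.
have [a [n [a0 n0 zV]]] := limw V (open_nbhs_nbhs (conj oV Vw)) d d0.
have nearz : \forall z' \near z,
    forall k : 'I_d.+1, V (iter (a + k * n)%N T z').
  apply: filter_forall => k; apply: (continuous_iter cT).
  by apply: open_nbhs_nbhs; split=> //; have [] := zV k (ltn_ord k).
have [b [m [b0 m0 xz]]] := limz _ nearz 1%N isT.
exists (a + b)%N, n; split=> // [|k kd]; first by rewrite addn_gt0 a0.
split; first by rewrite !addn_gt0 a0.
have [_ /(_ (Ordinal (kd : (k < d.+1)%N)))] := xz 0%N isT.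
rewrite mul0n addn0 -iterD /= => Vx; apply: VU.
by rewrite addnAC.
Qed.

(** * Lifting through a factor map *)

Lemma factor_iter (X Y : Type) (T : X -> X) (S : Y -> Y) (pi : X -> Y)
    (n : nat) (x : X) :
  pi \o T = S \o pi -> pi (iter n T x) = iter n S (pi x).
Proof. by move=> piT; elim: n => //= n <-; exact: (congr1 (@^~ _) piT). Qed.

(** Say that [A] is large when, for some neighbourhood [V] of [pi x], the visits
of [x] to [pi @^-1` V] outside [A] do not form an AP-set.  Partition regularity
makes the large sets a filter, recurrence of [pi x] makes it proper, and each
of its cluster points is an AP-limit lying above [pi x]: the complement of a
neighbourhood of a cluster point is never large. *)
Lemma AP_limit_set_fiber (X Y : topologicalType) (T : X -> X) (S : Y -> Y)
    (pi : X -> Y) (x : X) :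
  pi \o T = S \o pi -> continuous pi -> compact [set: X] ->
  hausdorff_space Y -> AP_limit_set S (pi x) (pi x) ->
  AP_limit_set T x `&` pi @^-1` [set pi x] !=set0.
Proof.
move=> piT cpi cX hY recy.
pose G : set_system X := [set A | exists2 V, nbhs (pi x) V &
  ~ AP_set (return_times T x (pi @^-1` V `\` A))].
have pG : ProperFilter G.
  split; last split.
  - move=> [V nV]; apply; apply: AP_setS (recy _ nV) => n [n0 Vn].
    by split=> //; split=> //; rewrite /preimage /= (factor_iter n x piT).
  - exists setT; first exact: filterT.
    by move=> /(_ 1%N isT)[a [n [_ _ /(_ 0%N isT)[_ [_]]]]]; apply.
  - move=> A B [V nV nA] [W nW nB]; exists (V `&` W); first exact: filterI.
    rewrite setDIr => apU.
    have /AP_setU[] : AP_set (return_times T x (pi @^-1` V `\` A) `|`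
        return_times T x (pi @^-1` W `\` B)) => //.
    apply: AP_setS apU => n [n0 [[[Vn Wn] nAn]|[[Vn Wn] nBn]]];
      by [left|right].
  - move=> A B AB [V nV nA]; exists V => // apB; apply: nA.
    by apply: AP_setS apB; apply: return_timesS; exact: setDS.
have [w [_ clw]] := cX _ pG filterT.
have limw U V : nbhs w U -> nbhs (pi x) V ->
    AP_set (return_times T x (U `&` pi @^-1` V)).
  move=> nU nV; apply: contrapT => nap.
  have GU : G (~` U) by exists V => //; rewrite setDE setCK setIC.
  by have [t []] := clw _ _ GU nU.
exists w; split.
  move=> U nU; apply: AP_setS (limw _ _ nU filterT).
  by apply: return_timesS => t [].
apply/esym/hY => V W nV /cpi nW.
have [a [n [_ _ /(_ 0%N isT)[_ [Wa Va]]]]] := limw _ _ nW nV 1%N isT.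
by exists (pi (iter (a + 0 * n) T x)).
Qed.

(** Zorn's lemma is applied to the points [x] of the fibre, preordered by
reverse inclusion of the sets [M x]; a point of [M x] for a minimal [M x] is
recurrent. *)
Lemma recurrent_lift (X Y : topologicalType) (T : X -> X) (S : Y -> Y)
    (pi : X -> Y) (y : Y) :
  pi \o T = S \o pi -> continuous pi -> compact [set: X] ->
  hausdorff_space Y -> continuous T -> (exists x, pi x = y) ->
  AP_limit_set S y y -> exists2 x, AP_limit_set T x x & pi x = y.
Proof.
move=> piT cpi cX hY cT [x0 px0] recy.
pose M x := AP_limit_set T x `&` pi @^-1` [set y].
have M0 x : pi x = y -> M x !=set0.
  move=> px; rewrite /M -px.
  by apply: (AP_limit_set_fiber piT cpi cX hY); rewrite px.
have Mtrans x z : M x z -> M z `<=` M x.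
  by move=> [limz _]; apply: setSI; exact: AP_limit_set_trans.
pose F := {x | pi x = y}.
pose le (r s : F) := `[< M (sval s) `<=` M (sval r) >].
have [||A totA|[x px] minx] := @ZL_preorder F (exist _ x0 px0) le.
- by move=> ?; apply/asboolP.
- by move=> r s t /asboolP sr /asboolP ts; apply/asboolP => ? /ts /sr.
- have [A0|/set0P A0] := eqVneq A set0.
    by exists (exist _ x0 px0) => s; rewrite A0.
  have pG : ProperFilter (filter_from A (fun s => M (sval s))).
    apply: filter_from_proper; last by move=> [s ps] _; exact: M0.
    apply: filter_from_filter => // s t As At.
    have [/asboolP st|/asboolP ts] := totA _ _ As At.
      by exists t => // z Mz; split=> //; exact: st.
    by exists s => // z Mz; split=> //; exact: ts.
  (* By compactness the sets [M s], for [s] in the chain, have a common point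
     [w]; it bounds the chain by transitivity. *)
  have [w [_ clw]] := cX _ pG filterT.
  have limw s : A s -> AP_limit_set T (sval s) w.
    move=> As; apply: closed_AP_limit_set => U nU.
    have [z [[Mz _] Uz]] := clw _ _ (ex_intro2 _ _ s As (@subset_refl _ _)) nU.
    by exists z.
  have pw : pi w = y.
    have [s As] := A0.
    apply/esym/hY => V W nV /cpi nW.
    have [z [[_ pz] Wz]] := clw _ _ (ex_intro2 _ _ s As (@subset_refl _ _)) nW.
    by exists (pi z); split=> //; rewrite [pi z]pz; exact: nbhs_singleton.
  exists (exist _ w pw) => s As; apply/asboolP.
  by apply: Mtrans; split=> //; exact: limw.
have [z Mz] := M0 x px; have [limz pz] := Mz.
exists z => //.
have /asboolP MxMz := minx (exist _ z pz) (asboolT (Mtrans _ _ Mz)).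
by have [] := MxMz _ Mz.
Qed.

(** * Metric systems *)

(** Open neighbourhoods can be replaced by all neighbourhoods because AP-sets
are stable under supersets. *)
Lemma AP_recurrentE (R : realType) (X : metricType R) (T : X -> X) (x : X) :
  AP_recurrent T x <-> AP_limit_set T x x.
Proof.
split=> rec U; last by move=> oU; apply: rec; exact: open_nbhs_nbhs.
by rewrite nbhsE => -[V oV VU]; apply: AP_setS (return_timesS VU) (rec _ oV).
Qed.

Theorem proposition4p11 (R : realType) (X Y : metricType R)
    (T : X -> X) (S : Y -> Y) (pi : X -> Y)
    (hT : dynamical_system T) (hS : dynamical_system S)
    (hpi : factor_map T S pi) (y : Y) (hy : AP_recurrent S y) :
  exists x : X, AP_recurrent T x /\ pi x = y.
Proof.
have [_ cX cT] := hT; have [cpi surj piT] := hpi.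
have [x0 _ px0] := surj y I.
have recy : AP_limit_set S y y by exact/AP_recurrentE.
have [x recx px] := recurrent_lift piT cpi cX (@metric_hausdorff _ Y) cT
  (ex_intro _ x0 px0) recy.
by exists x; split=> //; exact/AP_recurrentE.
Qed.
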